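(* Let $G\in\mathfrak{Y}_n$ be an infinite finitely generated soluble group. Then $G$ is abelian.
   Context: $\mathfrak{Y}_n$ denotes the class of all groups $G$ (finite or infinite) such that $N_G(A)=A$ for every non-abelian subgroup $A\le G$. *)

(* Defs.v *)
From Stdlib Require Import List.

Record Group := {
  carrier :> Type;
  gmul : carrier -> carrier -> carrier;
  ginv : carrier -> carrier;
  gone : carrier;
  gmul_assoc : forall x y z, gmul x (gmul y z) = gmul (gmul x y) z;
  gmul_1l : forall x, gmul gone x = x;
  gmul_1r : forall x, gmul x gone = x;
  gmul_Vl : forall x, gmul (ginv x) x = gone;
  gmul_Vr : forall x, gmul x (ginv x) = gone
}.

Section Defs.
Variable G : Group.

Definition is_subgroup (A : G -> Prop) : Prop :=
  A (gone G) /\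
  (forall x y, A x -> A y -> A (gmul G x y)) /\
  (forall x, A x -> A (ginv G x)).

Definition commute (x y : G) : Prop := gmul G x y = gmul G y x.

Definition abelian_set (A : G -> Prop) : Prop :=
  forall x y, A x -> A y -> commute x y.

Definition abelian_group : Prop := forall x y : G, commute x y.

Definition conj (a g : G) : G := gmul G (ginv G g) (gmul G a g).

Definition normalises (g : G) (A : G -> Prop) : Prop :=
  forall a, A a <-> A (conj a g).

Definition self_normalising (A : G -> Prop) : Prop :=
  forall g, normalises g A <-> A g.

Definition generated (S : G -> Prop) : G -> Prop :=
  fun x => forall H, is_subgroup H -> (forall s, S s -> H s) -> H x.

Definition commutator (x y : G) : G :=
  gmul G (gmul G (ginv G x) (ginv G y)) (gmul G x y).

Definition derived (A : G -> Prop) : G -> Prop :=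
  generated (fun z => exists x y, A x /\ A y /\ z = commutator x y).

Fixpoint derived_series (n : nat) : G -> Prop :=
  match n with
  | O => fun _ => True
  | S m => derived (derived_series m)
  end.

Definition soluble : Prop :=
  exists n, forall x, derived_series n x -> x = gone G.

Definition finitely_generated : Prop :=
  exists s : list G, forall x : G, generated (fun y => In y s) x.

Definition infinite_group : Prop :=
  forall s : list G, exists x : G, ~ In x s.

Definition in_Yn : Prop :=
  forall A : G -> Prop, is_subgroup A -> ~ abelian_set A -> self_normalising A.

End Defs.

(* Main.v *)
From Stdlib Require Import ZArith Lia List.
From HB Require Import structures.
From mathcomp Require Import all_boot all_algebra boolp.
From mathcomp Require Import ring zify.
Require Import Defs.

(* Suppose G is not abelian.  A nonabelian normal subgroup is self-normalising,
   hence equal to G; so G' is abelian by solubility, and every subgroup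
   containing G' is abelian or equal to G.

   If every subgroup <G', g> is abelian, then G' is central.  A noncommuting pair
   generates a subgroup containing the centre, hence normal, hence G.  With
   c = [x, y], the pair (x^2, y) shows that c has finite order m, and for
   n = m + 1 the pair (x^n, y^n) shows that G/G' is n-divisible.  Being finitely
   generated it is finite, so G is finite.

   Otherwise G = <G', g> for some g.  The least p > 0 for which g^p centralises G'
   is a prime, because any g^k not centralising G' satisfies G = <G', g^k>; the
   choice k = p + 1 shows that G/G' is finite.  So G' is finitely generated, and
   G' = [G', g].  Writing G' additively, (g - 1)^p = g^p - 1 = 0 modulo p, hence
   G' = p G', and Nakayama's lemma makes G' finite. *)

(** * Finitely generated abelian groups and automorphisms of prime order *)

Section Nakayama.
Import GRing.Theory.
Local Open Scope ring_scope.
Variable V : zmodType.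

(** The subgroup generated by [s], with one generator peeled off at a time so that proofs go by
    induction on the list. *)
Fixpoint int_span (s : seq V) (v : V) : Prop :=
  if s is b :: s' then exists k : int, int_span s' (v - b *~ k) else v = 0.

Lemma int_span0 s : int_span s 0.
Proof. by elim: s => [|b s IHs] //=; exists 0; rewrite mulr0z subr0. Qed.

Lemma int_spanD s v w : int_span s v -> int_span s w -> int_span s (v + w).
Proof.
elim: s v w => [|b s IHs] v w /=; first by move=> -> ->; rewrite addr0.
move=> [k vk] [l wl]; exists (k + l).
by rewrite mulrzDr opprD addrACA; apply: IHs.
Qed.

Lemma int_spanN s v : int_span s v -> int_span s (- v).
Proof.
elim: s v => [|b s IHs] v /=; first by move=> ->; rewrite oppr0.
by move=> [k vk]; exists (- k); rewrite mulrNz -opprD; apply: IHs.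
Qed.

Lemma int_spanMz s v (k : int) : int_span s v -> int_span s (v *~ k).
Proof.
move=> sv; have sMn n : int_span s (v *+ n).
  elim: n => [|n IHn]; first exact: int_span0.
  by rewrite mulrS; apply: int_spanD.
by case: k => n; [apply: sMn | apply/int_spanN/sMn].
Qed.

Lemma mem_int_span s b : List.In b s -> int_span s b.
Proof.
elim: s => [|a s IHs] //= [->|bs].
  by exists 1; rewrite mulr1z subrr; apply: int_span0.
by exists 0; rewrite mulr0z subr0; apply: IHs.
Qed.

Lemma int_span_killed s (D : int) v :
  (forall b, List.In b s -> b *~ D = 0) -> int_span s v -> v *~ D = 0.
Proof.
elim: s v => [|b s IHs] v kill /=; first by move=> ->; rewrite mul0rz.
move=> [k vk]; rewrite -(subrK (b *~ k) v) mulrzDl IHs //; last first.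
  by move=> c cs; apply: kill; right.
by rewrite mulrzAC (kill b) ?mul0rz ?addr0 //; left.
Qed.

(* Nakayama's lemma: the integers [1 + p q] are the ones that must be inverted,
   and generators are eliminated one at a time. *)
Lemma int_span_torsion (p : nat) s :
    (forall b, List.In b s -> exists q : int, exists2 w, int_span s w &
       b *~ (1 + p%:Z * q) = w *+ p) ->
  exists q : int, forall b, List.In b s -> b *~ (1 + p%:Z * q) = 0.
Proof.
elim: s => [|a s IHs] hyp; first by exists 0.
have [qa [w [k wk] eqa]] := hyp a (or_introl erefl).
(* Moving the term [a *~ k] of [w] to the left-hand side puts [a *~ N] into p times the span of [s];
   so multiplication by [N] maps the span of [a :: s] into that of [s]. *)
pose N : int := 1 + p%:Z * (qa - k).
have eqN : a *~ N = (w - a *~ k) *+ p.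
  rewrite /N mulrBr addrA mulrzBr eqa mulrnBl; congr (_ - _).
  by rewrite mulrC mulrzA pmulrn.
have sN v : int_span (a :: s) v -> int_span s (v *~ N).
  move=> [l vl]; rewrite -(subrK (a *~ l) v) mulrzDl; apply: int_spanD.
    exact: int_spanMz.
  rewrite mulrzAC eqN pmulrn; do 2!apply: int_spanMz; exact: wk.
case: IHs => [b bs|q qs].
  have [qb [u su eqb]] := hyp b (or_intror bs).
  (* The witness is read off from [N * (1 + p%:Z * qb)]: integers congruent to 1 modulo p are closed
     under products. *)
  exists (qb + (qa - k) + p%:Z * (qb * (qa - k))), (u *~ N); first exact: sN.
  rewrite pmulrn mulrzAC -pmulrn -eqb -mulrzA; congr (_ *~ _).
  rewrite /N; ring.
exists (q + (qa - k) + p%:Z * (q * (qa - k))) => b.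
have -> : 1 + p%:Z * (q + (qa - k) + p%:Z * (q * (qa - k)))
   = N * (1 + p%:Z * q) by rewrite /N; ring.
rewrite mulrzA => bs; apply: (@int_span_killed s) => //.
exact/sN/mem_int_span.
Qed.

(** Coefficients can be reduced modulo [D], which leaves finitely many combinations. *)
Lemma int_span_finite (D : nat) s : (0 < D)%N ->
    (forall b, List.In b s -> b *+ D = 0) ->
  exists t : seq V, forall v, int_span s v -> List.In v t.
Proof.
move=> D_gt0; elim: s => [|b s IHs] hyp.
  by exists [:: 0] => v /= ->; left.
case: IHs => [c cs|t st]; first by apply: hyp; right.
exists (List.flat_map (fun k => List.map (fun w => b *+ k + w) t) (iota 0 D)).
move=> v /= [k vk]; have bD : b *+ D = 0 by apply: hyp; left.
have [r ltrD eqr] : exists2 r, (r < D)%N & b *~ k = b *+ r.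
  exists `|(k %% D%:Z)%Z|%N.
    by have := ltz_pmod k (d := D%:Z); have := modz_ge0 k (d := D%:Z); lia.
  have -> : b *+ `|(k %% D%:Z)%Z|%N = b *~ (k %% D%:Z)%Z.
    by rewrite pmulrn gez0_abs ?modz_ge0 //; lia.
  rewrite {1}(divz_eq k D%:Z) mulrzDr mulrC mulrzA -pmulrn bD mul0rz add0r //.
apply/List.in_flat_map; exists r; split.
  have: r \in iota 0 D by rewrite mem_iota.
  by elim: (iota 0 D) => //= a l IHl; rewrite inE => /orP[/eqP->|/IHl]; auto.
apply/List.in_map_iff; exists (v - b *~ k); split; last exact: st.
by rewrite -eqr addrC subrK.
Qed.

(** The binomial theorem for f = 1 + d with d = f - 1; the induction step is Pascal's rule. *)
Lemma iter_bin (f : {additive V -> V}) n v :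
  iter n f v = \sum_(i < n.+1) iter i (fun w => f w - w) v *+ 'C(n, i).
Proof.
set d := fun w => f w - w.
elim: n => [|n IHn]; first by rewrite big_ord_recl big_ord0 addr0 bin0.
rewrite iterS IHn raddf_sum.
rewrite [RHS]big_ord_recl bin0 /=.
under [X in _ = _ + X]eq_bigr => i _ do rewrite /bump /= add1n binS mulrnDr.
rewrite big_split /= [X in _ = _ + (X + _)]big_ord_recr /= bin_small // mulr0n addr0.
rewrite addrA.
have -> : v *+ 1 + \sum_(i < n) d (iter i d v) *+ 'C(n, i.+1)
   = \sum_(i < n.+1) iter i d v *+ 'C(n, i).
  by rewrite [RHS]big_ord_recl bin0.
rewrite -big_split /=; apply: eq_bigr => i _.
by rewrite raddfMn -mulrnDl /d addrC subrK.
Qed.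

(* In the ring of endomorphisms modulo p, (f - 1)^p = f^p - 1 = 0. *)
Lemma unipotent_divisible (p : nat) (f : {additive V -> V}) :
    prime p -> (forall v, iter p f v = v) ->
    (forall v : V, exists w : V, v = f w - w) ->
  forall v : V, exists w : V, v = w *+ p.
Proof.
move=> p_pr fp fsurj v; set d := fun w => f w - w.
have dsurj n : exists w, v = iter n d w.
  elim: n => [|n [w ->]]; first by exists v.
  by have [u ->] := fsurj w; exists u; rewrite iterSr.
have [w ->] := dsurj p.
have := fp w; case: p p_pr {fp dsurj} => // p p_pr.
(* Cancelling the term of index 0 in f^p w = w expresses d^p w by the middle terms, whose binomial
   coefficients are divisible by the prime. *)
rewrite iter_bin -/d big_ord_recr big_ord_recl /= bin0 !mulr1n binn mulr1n -addrA.
rewrite -[RHS]addr0 => /addrI/eqP; rewrite addrC addr_eq0 => /eqP->.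
exists (- \sum_(i < p) iter i.+1 d w *+ ('C(p.+1, i.+1) %/ p.+1)).
rewrite mulNrn -sumrMnl; congr (- _); apply: eq_bigr => i _.
rewrite -mulrnA divnK // prime_dvd_bin //= ltnS; exact: ltn_ord.
Qed.

(** Here V = pV, so Nakayama gives an integer D = 1 + pq that kills [s]. It is nonzero because p >
    1, so V is finitely generated of finite exponent. *)
Lemma prime_order_action_finite (p : nat) (f : {additive V -> V}) s :
    prime p -> (forall v, iter p f v = v) ->
    (forall v : V, exists w : V, v = f w - w) ->
    (forall v, int_span s v) ->
  exists t : seq V, forall v, List.In v t.
Proof.
move=> p_pr fp fsurj sV.
have divp := unipotent_divisible p f p_pr fp fsurj.
have [b _|q qs] := @int_span_torsion p s.
  have [w eqw] := divp b; exists 0, w => //.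
  by rewrite mulr0 addr0 mulr1z.
pose D : int := 1 + p%:Z * q.
have D_neq0 : D != 0 by move: (prime_gt1 p_pr); rewrite /D; case: (q) => n; nia.
have [||t st] := @int_span_finite `|D|%N s; first by rewrite absz_gt0.
  move=> b /qs; rewrite -/D; case: (D) => n //= /eqP.
  by rewrite NegzE mulrNz oppr_eq0 => /eqP.
by exists t => v; apply: st.
Qed.
End Nakayama.

(** * Conjugation, commutators and integer powers *)

Section Groups.
Local Open Scope Z_scope.
Variable G : Group.
Local Notation "x ** y" := (gmul G x y) (at level 40, left associativity).
Local Notation inv := (ginv G).
Local Notation e := (gone G).
Local Notation conj := (conj G).
Local Notation commute := (commute G).
Local Notation commutator := (commutator G).
Local Notation generated := (generated G).
Local Notation is_subgroup := (is_subgroup G).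
Local Notation abelian_set := (abelian_set G).
Local Notation G' := (derived G (fun _ => True)).

Lemma gmulKl x y : inv x ** (x ** y) = y.
Proof. by rewrite gmul_assoc gmul_Vl gmul_1l. Qed.

Lemma gmulVKl x y : x ** (inv x ** y) = y.
Proof. by rewrite gmul_assoc gmul_Vr gmul_1l. Qed.

Lemma gmul_inj x y z : x ** y = x ** z -> y = z.
Proof. by move=> eqx; rewrite -(gmulKl x y) eqx gmulKl. Qed.

Lemma ginvK x : inv (inv x) = x.
Proof. by apply: (@gmul_inj (inv x)); rewrite gmul_Vr gmul_Vl. Qed.

Lemma ginvM x y : inv (x ** y) = inv y ** inv x.
Proof.
by apply: (@gmul_inj (x ** y)); rewrite gmul_Vr -gmul_assoc gmulVKl gmul_Vr.
Qed.

Lemma ginv1 : inv e = e.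
Proof. by apply: (@gmul_inj e); rewrite gmul_Vr gmul_1l. Qed.

Ltac gsimp := rewrite /Defs.conj /Defs.commutator;
  repeat (progress rewrite ?ginvM ?ginvK ?ginv1 -?gmul_assoc ?gmulKl ?gmulVKl
    ?gmul_Vl ?gmul_Vr ?gmul_1l ?gmul_1r).

Lemma conjM a b g : conj (a ** b) g = conj a g ** conj b g.
Proof. by gsimp. Qed.

Lemma conjV a g : conj (inv a) g = inv (conj a g).
Proof. by gsimp. Qed.

Lemma conjJ a g h : conj (conj a g) h = conj a (g ** h).
Proof. by gsimp. Qed.

Lemma conj1 a : conj a e = a.
Proof. by gsimp. Qed.

Lemma conj_commute a g : commute a g -> conj a g = a.
Proof. by rewrite /conj => ->; gsimp. Qed.

Lemma commutatorP x y : commute x y <-> commutator x y = e.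
Proof.
rewrite /Defs.commute; split=> [eqxy | eq1]; first by gsimp; rewrite eqxy; gsimp.
by apply: (@gmul_inj (inv (y ** x))); rewrite gmul_Vl -eq1; gsimp.
Qed.

Lemma commutator_swap x y : x ** y = y ** x ** commutator x y.
Proof. by gsimp. Qed.

Lemma commutatorV x y : inv (commutator x y) = commutator y x.
Proof. by gsimp. Qed.

Lemma commutatorMl x y z :
  commutator (x ** y) z = conj (commutator x z) y ** commutator y z.
Proof. by gsimp. Qed.

Lemma commutatorVl x z :
  commutator (inv x) z = conj (inv (commutator x z)) (inv x).
Proof. by gsimp. Qed.

Lemma commuteMr x y z : commute x y -> commute x z -> commute x (y ** z).
Proof.
rewrite /Defs.commute => xy xz.
by rewrite gmul_assoc xy -gmul_assoc xz gmul_assoc.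
Qed.

Lemma commuteVr x y : commute x y -> commute x (inv y).
Proof.
rewrite /Defs.commute => xy; apply: (@gmul_inj y).
by rewrite gmul_assoc -xy; gsimp.
Qed.

Lemma commute1r x : commute x e.
Proof. by rewrite /Defs.commute gmul_1l gmul_1r. Qed.

Lemma commute_subgroup x : is_subgroup (commute x).
Proof.
split; [exact: commute1r | split=> [y z | y]].
  exact: commuteMr.
exact: commuteVr.
Qed.

Definition gpow (x : G) (k : Z) : G :=
  match k with
  | Z0 => e
  | Zpos n => Pos.iter (gmul G x) e n
  | Zneg n => Pos.iter (gmul G (inv x)) e n
  end.
Local Notation "x ^^ k" := (gpow x k) (at level 30).

Lemma gpowS x k : x ^^ Z.succ k = x ** x ^^ k.
Proof.
case: k => [|n|n] //=; first by rewrite Pos.add_1_r Pos.iter_succ.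
elim/Pos.peano_ind: n => [|n _] /=; first by gsimp.
rewrite Z.pos_sub_lt ?Pos.sub_1_r ?Pos.pred_succ; last exact: Pos.lt_1_succ.
by rewrite Pos.iter_succ /= gmulVKl.
Qed.

Lemma gpowP x k : x ^^ Z.pred k = inv x ** x ^^ k.
Proof. by rewrite -{2}(Z.succ_pred k) gpowS gmulKl. Qed.

Lemma gpow1 x : x ^^ 1 = x.
Proof. by rewrite /= gmul_1r. Qed.

Lemma gpowD x k l : x ^^ (k + l) = x ^^ k ** x ^^ l.
Proof.
elim/Z.peano_ind: k => [|k IHk|k IHk]; first by rewrite gmul_1l.
  by rewrite Z.add_succ_l !gpowS IHk gmul_assoc.
by rewrite Z.add_pred_l !gpowP IHk gmul_assoc.
Qed.

Lemma gpowN x k : x ^^ (- k) = inv (x ^^ k).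
Proof.
by apply: (@gmul_inj (x ^^ k)); rewrite -gpowD gmul_Vr Z.add_opp_diag_r.
Qed.

Lemma gpowB x k l : x ^^ (k - l) = x ^^ k ** inv (x ^^ l).
Proof. by rewrite -gpowN -gpowD. Qed.

Lemma gpowN1 x : x ^^ (-1) = inv x.
Proof. by rewrite /= gmul_1r. Qed.

Lemma gpowM x k l : x ^^ (k * l) = (x ^^ k) ^^ l.
Proof.
elim/Z.peano_ind: l => [|l IHl|l IHl]; first by rewrite Z.mul_0_r.
  by rewrite Z.mul_succ_r Z.add_comm gpowD IHl gpowS.
by rewrite gpowP -IHl -gpowN -gpowD; congr gpow; lia.
Qed.

Lemma gpow_one k : e ^^ k = e.
Proof.
by elim/Z.peano_ind: k => // k; rewrite ?gpowS ?gpowP => ->; gsimp.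
Qed.

Lemma subgroup_gpow H x k : is_subgroup H -> H x -> H (x ^^ k).
Proof.
move=> [H1 [HM HV]] Hx; elim/Z.peano_ind: k => // k Hk.
  by rewrite gpowS; apply: HM.
by rewrite gpowP; apply: HM => //; apply: HV.
Qed.

Lemma commute_gpow x y k : commute x y -> commute x (y ^^ k).
Proof. by apply: subgroup_gpow; apply: commute_subgroup. Qed.

Lemma gpow_mul x y k : commute x y -> (x ** y) ^^ k = x ^^ k ** y ^^ k.
Proof.
move=> cxy; elim/Z.peano_ind: k => [|k IHk|k IHk]; first by gsimp.
  rewrite !gpowS IHk -!gmul_assoc; congr (_ ** _); rewrite !gmul_assoc.
  by congr (_ ** _); apply: commute_gpow.
rewrite !gpowP IHk ginvM -(commuteVr _ _ (esym (commuteVr _ _ (esym cxy)))).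
rewrite -!gmul_assoc; congr (_ ** _); rewrite !gmul_assoc; congr (_ ** _).
by apply: commute_gpow; apply/esym/commuteVr.
Qed.

Lemma conj_gpow a g k l : conj (conj a (g ^^ k)) (g ^^ l) = conj a (g ^^ (k + l)).
Proof. by rewrite conjJ gpowD. Qed.

(** * Generated subgroups, the derived subgroup and cyclic extensions *)

Lemma generated_subgroup S : is_subgroup (generated S).
Proof.
split; first by move=> H [].
split=> [x y Sx Sy H sH HS | x Sx H sH HS].
  by case: (sH) => _ [HM _]; apply: HM; [apply: Sx | apply: Sy].
by case: (sH) => _ [_ HV]; apply: HV; apply: Sx.
Qed.

Lemma mem_generated (S : G -> Prop) x : S x -> generated S x.
Proof. by move=> Sx H _; apply. Qed.

Definition normal (N : G -> Prop) := forall a g, N a -> N (conj a g).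

(** The images of [S] generate G/K and commute pairwise, so G/K is abelian. *)
Lemma derived_min (K S : G -> Prop) :
    is_subgroup K -> normal K -> (forall x, generated S x) ->
    (forall x y, S x -> S y -> K (commutator x y)) ->
  forall z, G' z -> K z.
Proof.
move=> sK nK genS cS; have [K1 [KM KV]] := sK.
(* The centraliser of [y] modulo [K]; it is applied first to y in [S], then to arbitrary y. *)
have cent y : is_subgroup (fun x => K (commutator x y)).
  split; first by rewrite (_ : commutator e y = e) //; gsimp.
  split=> [x z Kx Kz | x Kx]; first by rewrite commutatorMl; apply: KM => //; apply: nK.
  by rewrite commutatorVl; apply: nK; apply: KV.
have Ks y x : S y -> K (commutator x y).
  by move=> Sy; apply: genS (cent y) _ => s Ss; apply: cS.
move=> z; apply=> // _ [x [y [_ [_ ->]]]].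
apply: genS (cent y) _ => s Ss.
by rewrite -commutatorV; apply: KV; apply: Ks.
Qed.

Lemma derived_subgroup : is_subgroup G'.
Proof. exact: generated_subgroup. Qed.

Lemma commutator_derived x y : G' (commutator x y).
Proof. by apply: mem_generated; exists x, y. Qed.

Lemma normal_over_derived K :
  is_subgroup K -> (forall z, G' z -> K z) -> normal K.
Proof.
move=> [_ [KM _]] dK a g Ka.
have -> : conj a g = a ** commutator a g by gsimp.
by apply: KM => //; apply: dK; apply: commutator_derived.
Qed.

(** Powers of [g] normalise [H], so the product set of [H] and the powers of [g] is already a
    subgroup. *)
Lemma cyclic_extension_form (H : G -> Prop) g :
    is_subgroup H -> (forall a k, H a -> H (conj a (g ^^ k))) ->
  forall x, generated (fun y => H y \/ y = g) x ->
  exists a k, H a /\ x = a ** g ^^ k.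
Proof.
move=> [H1 [HM HV]] nH x gx.
apply: (gx (fun x => exists a k, H a /\ x = a ** g ^^ k)); last first.
  move=> s [Hs|->]; first by exists s, 0; split=> //=; rewrite gmul_1r.
  by exists e, 1; rewrite gpow1 gmul_1l.
split; first by exists e, 0; rewrite gmul_1l.
split=> [_ _ [a [k [Ha ->]]] [b [l [Hb ->]]] | _ [a [k [Ha ->]]]].
  exists (a ** conj b (g ^^ (- k))), (k + l); split; first by apply: HM => //; apply: nH.
  by rewrite gpowD gpowN; gsimp.
exists (conj (inv a) (g ^^ k)), (- k); split; first by apply: nH; apply: HV.
by rewrite gpowN; gsimp.
Qed.

(** Finitely many representatives of the powers of [x] modulo those of x^m; x^m need not be
    trivial. *)
Lemma gpow_mod_list x m : 0 < m ->
  exists L, forall k, List.In (x ^^ (k mod m)) L.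
Proof.
move=> m_gt0; exists (List.map (fun i => x ^^ Z.of_nat i) (List.seq 0 (Z.to_nat m))).
move=> k; have ? := Z.mod_pos_bound k m m_gt0.
apply/List.in_map_iff; exists (Z.to_nat (k mod m)).
by split; [rewrite Z2Nat.id //; lia | apply/List.in_seq; lia].
Qed.

Lemma gmul_list L1 L2 :
  exists L, forall a b, List.In a L1 -> List.In b L2 -> List.In (a ** b) L.
Proof.
exists (List.flat_map (fun a => List.map (gmul G a) L2) L1) => a b L1a L2b.
apply/List.in_flat_map; exists a; split=> //.
by apply/List.in_map_iff; exists b.
Qed.

Lemma gpow_div_mod x m k : x ^^ k = (x ^^ m) ^^ (k / m) ** x ^^ (k mod m).
Proof. by rewrite -gpowM -gpowD; congr gpow; apply: Z_div_mod_eq_full. Qed.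

Lemma torsion_list x m : 0 < m -> x ^^ m = e ->
  exists L, forall k, List.In (x ^^ k) L.
Proof.
move=> m_gt0 xm; have [L HL] := gpow_mod_list x m m_gt0.
by exists L => k; rewrite (gpow_div_mod x m) xm gpow_one gmul_1l.
Qed.

(** * Nonabelian groups in the class: normal subgroups and the derived subgroup *)

Section NonabelianYn.
Hypotheses (YnG : in_Yn G) (nabG : ~ abelian_group G).

Lemma normal_nonabelian_full N :
  is_subgroup N -> normal N -> ~ abelian_set N -> forall x, N x.
Proof.
move=> sN nN nab x; apply/(YnG N sN nab) => a; split; first exact: nN.
(* [normalises] is an equivalence; its converse half is normality applied to the inverse of [x]. *)
by move=> /(nN _ (inv x)); rewrite conjJ gmul_Vr conj1.
Qed.

(** A nonabelian G' would be all of G, making the derived series constant and G trivial by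
    solubility. *)
Lemma derived_abelian : soluble G -> abelian_set G'.
Proof.
move=> [n soln]; apply: contrapT => nab.
have full : forall x, G' x.
  apply: normal_nonabelian_full nab; first exact: derived_subgroup.
  by apply: normal_over_derived => //; apply: derived_subgroup.
have full_n m : forall x, derived_series G m x.
  elim: m => [//|m IHm] x /=; apply: full; first exact: generated_subgroup.
  by move=> _ [y [z [_ [_ ->]]]]; apply: mem_generated; exists y, z.
by apply: nabG => x y; rewrite (soln x (full_n n x)) (soln y (full_n n y)).
Qed.

Lemma over_derived_abelian_or_full K :
    is_subgroup K -> (forall z, G' z -> K z) ->
  abelian_set K \/ forall x, K x.
Proof.
move=> sK dK; case: (EM (abelian_set K)) => [|nab]; [by left | right].
by apply: normal_nonabelian_full => //; apply: normal_over_derived.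
Qed.

(** * The case of a central derived subgroup *)

Section CentralDerived.
Hypothesis centG' : forall a z, G' a -> commute a z.

(** The nonabelian subgroup generated by [u] and [v] is normalised by the central G', hence contains
    it and is normal, hence is everything. *)
Lemma noncommuting_generate u v :
  ~ commute u v -> forall z, generated (fun s => s = u \/ s = v) z.
Proof.
move=> ncuv; pose H := generated (fun s => s = u \/ s = v).
have sH : is_subgroup H by apply: generated_subgroup.
have nab : ~ abelian_set H.
  by move=> abH; apply/ncuv/abH; apply: mem_generated; auto.
have dH a : G' a -> H a.
  move=> da; apply/(YnG H sH nab) => x.
  by rewrite conj_commute //; apply/esym/centG'.
by case: (over_derived_abelian_or_full H).
Qed.

(** Reordering powers of [u] and [v] costs only commutators, which are central and are collected in
    the last factor. *)
Lemma class2_form u v : ~ commute u v ->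
  forall z, exists i j a, G' a /\ z = u ^^ i ** v ^^ j ** a.
Proof.
move=> ncuv z; have [d1 [dM dV]] := derived_subgroup.
apply: (noncommuting_generate u v ncuv z
  (fun z => exists i j a, G' a /\ z = u ^^ i ** v ^^ j ** a)); last first.
  move=> s [->|->]; first by exists 1, 0, e; rewrite gpow1 !gmul_1r.
  by exists 0, 1, e; rewrite gpow1 gmul_1l gmul_1r.
split; first by exists 0, 0, e; rewrite !gmul_1l.
split=> [_ _ [i [j [a [da ->]]]] [k [l [b [db ->]]]] | _ [i [j [a [da ->]]]]].
  exists (i + k), (j + l), (commutator (v ^^ j) (u ^^ k) ** (a ** b)); split.
    by apply: (dM); [apply: commutator_derived | apply: dM].
  have dc := commutator_derived (v ^^ j) (u ^^ k).
  move: dc (commutator_swap (v ^^ j) (u ^^ k)); move: (commutator _ _) => c dc eqc.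
  rewrite !gpowD -!gmul_assoc; congr (_ ** _).
  rewrite (gmul_assoc G a) (centG' a _ da) -!gmul_assoc (gmul_assoc G (v ^^ j)) eqc.
  rewrite -!gmul_assoc; do 2!congr (_ ** _).
  rewrite !gmul_assoc; congr (_ ** b); rewrite -[RHS]gmul_assoc.
  by apply: centG'; apply: dM.
have dc := commutator_derived (v ^^ (- j)) (u ^^ (- i)).
exists (- i), (- j), (commutator (v ^^ (- j)) (u ^^ (- i)) ** inv a); split.
  by apply: dM => //; apply: dV.
rewrite !ginvM -!gpowN (centG' _ _ (dV _ da)) gmul_assoc; congr (_ ** _).
exact: commutator_swap.
Qed.

(** Since G' is central, the commutator is a homomorphism in its first argument. *)
Lemma commutator_gpowl x y k : commutator (x ^^ k) y = commutator x y ^^ k.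
Proof.
have cM u v : commutator (u ** v) y = commutator u y ** commutator v y.
  by rewrite commutatorMl conj_commute //; apply: centG'; apply: commutator_derived.
elim/Z.peano_ind: k => [|k IHk|k IHk]; first by gsimp.
  by rewrite !gpowS cM IHk.
rewrite !gpowP cM IHk commutatorVl conj_commute //.
by apply: centG'; case: derived_subgroup => _ [_ dV]; apply: dV;
  apply: commutator_derived.
Qed.

Lemma commutator_gpowr x y k : commutator x (y ^^ k) = commutator x y ^^ k.
Proof.
rewrite -(commutatorV (y ^^ k)) -(commutatorV y) commutator_gpowl -gpowN.
have -> : inv (commutator y x) = commutator y x ^^ (-1) by rewrite gpowN1.
by rewrite -gpowM; congr gpow; lia.
Qed.

(** The powers of the central [u, v] form a normal subgroup containing all commutators of the
    generators [u] and [v]. *)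
Lemma derived_cyclic u v : ~ commute u v ->
  forall a, G' a -> exists k, a = commutator u v ^^ k.
Proof.
move=> ncuv; set c := commutator u v.
have dc : G' c by apply: commutator_derived.
apply: (derived_min (fun a => exists k, a = c ^^ k) _ _ _
  (noncommuting_generate u v ncuv)).
- split; first by exists 0.
  split=> [_ _ [k ->] [l ->] | _ [k ->]].
    by exists (k + l); rewrite gpowD.
  by exists (- k); rewrite gpowN.
- move=> _ g [k ->]; exists k; apply: conj_commute; apply: centG'.
  exact: subgroup_gpow derived_subgroup dc.
- move=> x y [->|->] [->|->].
  + by exists 0; apply/commutatorP.
  + by exists 1; rewrite gpow1.
  + by exists (-1); rewrite gpowN1 commutatorV.
  + by exists 0; apply/commutatorP.
Qed.

(** If c^2 is nontrivial, x^2 and [y] do not commute, so [x^2, y] = c^2 also generates G'. Then c =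
    c^(2k), and 2k - 1 is odd, hence nonzero. *)
Lemma derived_exponent x y : ~ commute x y ->
  exists m, 0 < m /\ commutator x y ^^ m = e.
Proof.
move=> ncxy; set c := commutator x y.
suff [m [m0 cm]] : exists m, m <> 0 /\ c ^^ m = e.
  exists (Z.abs m); split; first lia.
  by case: (Z.abs_eq_or_opp m) => ->; rewrite ?gpowN cm ?ginv1.
case: (EM (c ^^ 2 = e)) => [c2|nc2]; first by exists 2.
have [|k eqk] := derived_cyclic (x ^^ 2) y _ c (commutator_derived x y).
  by move/commutatorP; rewrite commutator_gpowl.
exists (2 * k - 1); split; first lia.
by rewrite gpowB gpow1 gpowM -commutator_gpowl -eqk gmul_Vr.
Qed.

(* [n] is chosen with c^(n^2) = c, so that x^n and y^n still generate G. *)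
Lemma generator_order x y : ~ commute x y ->
  exists E, 0 < E /\ x ^^ E = e /\ y ^^ E = e /\ commutator x y ^^ E = e.
Proof.
move=> ncxy; set c := commutator x y.
have [m [m0 cm]] := derived_exponent x y ncxy.
pose n := 1 + m.
have ncn : ~ commute (x ^^ n) (y ^^ n).
  move/commutatorP; rewrite commutator_gpowl commutator_gpowr -gpowM -/c.
  have -> : n * n = 1 + m * (2 + m) by rewrite /n; lia.
  by rewrite gpowD gpowM cm gpow_one gpow1 gmul_1r => /commutatorP.
have am a : G' a -> a ^^ m = e.
  move=> /(derived_cyclic x y ncxy)[k ->].
  by rewrite -gpowM Z.mul_comm gpowM cm gpow_one.
have form := class2_form _ _ ncn.
have [i [j [a [da eqx]]]] := form x.
have [i' [j' [b [db eqy]]]] := form y.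
rewrite -!gpowM in eqx eqy.
(* Collecting powers of [x] in [eqx] leaves the central factor [a], which the m-th power kills. *)
have relx : x ^^ (m * (1 - n * i)) = y ^^ (m * (n * j)).
  have -> : m * (1 - n * i) = (1 - n * i) * m by lia.
  have -> : m * (n * j) = (n * j) * m by lia.
  rewrite !gpowM; have -> : x ^^ (1 - n * i) = y ^^ (n * j) ** a.
    apply: (@gmul_inj (x ^^ (n * i))); rewrite -gpowD gmul_assoc -eqx.
    by rewrite -[RHS]gpow1; congr gpow; lia.
  rewrite gpow_mul ?(am a da) ?gmul_1r ?gpowM //; exact/esym/centG'.
have rely : y ^^ (m * (1 - n * j')) = x ^^ (m * (n * i')).
  have -> : m * (1 - n * j') = (1 - n * j') * m by lia.
  have -> : m * (n * i') = (n * i') * m by lia.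
  rewrite !gpowM; have -> : y ^^ (1 - n * j') = x ^^ (n * i') ** b.
    rewrite gpowB gpow1 {1}eqy -!gmul_assoc; congr (_ ** _).
    by rewrite (centG' b _ db) gmul_assoc gmul_Vr gmul_1l.
  rewrite gpow_mul ?(am b db) ?gmul_1r ?gpowM //; exact/esym/centG'.
(* The determinant of the two linear relations between exponents. It is 1 modulo n and n > 1, so it
   is nonzero; elimination then bounds the orders of [x] and [y]. *)
pose D := (1 - n * i) * (1 - n * j') - n * n * i' * j.
have D0 : D <> 0.
  have [t ->] : exists t, D = 1 - n * t.
    by exists (i + j' - n * i * j' + n * i' * j); rewrite /D; lia.
  have [t0|t0] : t <= 0 \/ 1 <= t by lia.
    by rewrite /n; nia.
  by rewrite /n; nia.
have xD : x ^^ (m * D) = e.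
  have -> : m * D = m * (1 - n * i) * (1 - n * j') + - (m * (n * i') * (n * j)).
    by rewrite /D; lia.
  have eq1 : x ^^ (m * (1 - n * i) * (1 - n * j')) = x ^^ (m * (n * i') * (n * j)).
    rewrite gpowM relx (gpowM _ (m * (n * i'))) -rely -!gpowM.
    by congr gpow; lia.
  by rewrite gpowD gpowN eq1 gmul_Vr.
have yD : y ^^ (m * D) = e.
  have -> : m * D = m * (1 - n * j') * (1 - n * i) + - (m * (n * j) * (n * i')).
    by rewrite /D; lia.
  have eq1 : y ^^ (m * (1 - n * j') * (1 - n * i)) = y ^^ (m * (n * j) * (n * i')).
    rewrite gpowM rely (gpowM _ (m * (n * j))) -relx -!gpowM.
    by congr gpow; lia.
  by rewrite gpowD gpowN eq1 gmul_Vr.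
have cD : c ^^ (m * D) = e by rewrite gpowM cm gpow_one.
exists (Z.abs (m * D)); split; first lia.
by case: (Z.abs_eq_or_opp (m * D)) => ->; rewrite ?gpowN xD yD cD ?ginv1.
Qed.

(** Every element is x^i y^j c^k, and all three factors are torsion. *)
Lemma central_derived_finite : ~ infinite_group G.
Proof.
move=> infG; apply: nabG => x y; apply: contrapT => ncxy.
have [E [E0 [xE [yE cE]]]] := generator_order x y ncxy.
have [Lx HLx] := torsion_list x E E0 xE.
have [Ly HLy] := torsion_list y E E0 yE.
have [Lc HLc] := torsion_list _ E E0 cE.
have [L1 HL1] := gmul_list Lx Ly; have [L HL] := gmul_list L1 Lc.
have [z []] := infG L.
have [i [j [a [da ->]]]] := class2_form x y ncxy z.
have [k ->] := derived_cyclic x y ncxy a da.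
by apply: HL => //; apply: HL1.
Qed.

End CentralDerived.

(** * The case where G is generated by an abelian G' and one element g *)

Section CyclicQuotient.
Variable g : G.
Hypotheses (abG' : abelian_set G')
  (genG : forall x, generated (fun y => G' y \/ y = g) x).

Lemma normal_derived : normal G'.
Proof. by apply: normal_over_derived => //; apply: derived_subgroup. Qed.

Lemma cyclic_quotient_form x : exists a k, G' a /\ x = a ** g ^^ k.
Proof.
apply: cyclic_extension_form (genG x); first exact: derived_subgroup.
by move=> a k; apply: normal_derived.
Qed.

(** By the next two lemmas these exponents are closed under sums and multiples; they measure the
    order of the automorphism that [g] induces on G'. *)
Definition acts_trivially (k : Z) := forall a, G' a -> commute a (g ^^ k).

Lemma acts_triviallyD k l :
  acts_trivially k -> acts_trivially l -> acts_trivially (k + l).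
Proof. by move=> tk tl a da; rewrite gpowD; apply: commuteMr; auto. Qed.

Lemma acts_triviallyM k l : acts_trivially k -> acts_trivially (k * l).
Proof. by move=> tk a da; rewrite gpowM; apply: commute_gpow; apply: tk. Qed.

Lemma acts_trivially_in k : G' (g ^^ k) -> acts_trivially k.
Proof. by move=> dk a da; apply: abG'. Qed.

Lemma acts_nontrivially1 : ~ acts_trivially 1.
Proof.
move=> t1; apply: nabG => x y.
have [a [k [da ->]]] := cyclic_quotient_form x.
have [b [l [db ->]]] := cyclic_quotient_form y.
have tk i c : G' c -> commute (g ^^ i) c.
  by move=> dc; apply: esym; rewrite -(Z.mul_1_l i); apply: acts_triviallyM.
apply: commuteMr; apply: esym; apply: commuteMr.
- exact: abG'.
- by apply: esym; apply: tk.
- by apply: tk.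
- by rewrite /Defs.commute -!gpowD Z.add_comm.
Qed.

(** The subgroup generated by G' and g^k is abelian or all of G; in the latter case it contains g =
    a g^(ki) with a in G'. *)
Lemma acts_trivially_or_generates k :
  acts_trivially k \/ exists i, G' (g ^^ (1 - k * i)).
Proof.
pose K := generated (fun y => G' y \/ y = g ^^ k).
have [||abK|fullK] := over_derived_abelian_or_full K.
- exact: generated_subgroup.
- by move=> z dz; apply: mem_generated; left.
- by left=> a da; apply: abK; apply: mem_generated; auto.
right; have [||a [i [da eqg]]] := cyclic_extension_form G' (g ^^ k) _ _ g (fullK g).
- exact: derived_subgroup.
- by move=> a i; apply: normal_derived.
exists i; rewrite -gpowM in eqg.
by rewrite gpowB gpow1 {1}eqg -gmul_assoc gmul_Vr gmul_1r.
Qed.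

Lemma action_prime_order :
  exists p : nat, prime p /\ acts_trivially (Z.of_nat p).
Proof.
have [t t_gt0 tt] : exists2 t : nat, (0 < t)%N & acts_trivially (Z.of_nat t).
  have [t t0 tt] : exists2 t, t <> 0 & acts_trivially t.
    (* Either 2 or the odd, hence nonzero, number 1 - 2i acts trivially. *)
    case: (acts_trivially_or_generates 2) => [|[i di]]; first by exists 2.
    by exists (1 - 2 * i); [lia | apply: acts_trivially_in].
  exists (Z.to_nat (Z.abs t)); first lia.
  rewrite Z2Nat.id; last lia.
  by rewrite -Z.sgn_abs; apply: acts_triviallyM.
pose P n := (0 < n)%N && `[< acts_trivially (Z.of_nat n) >].
have exP : exists n, P n by exists t; rewrite /P t_gt0; apply/asboolP.
case: (ex_minnP exP) => p /andP[p_gt0 /asboolP tp] minp.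
have lt_min n : (0 < n < p)%N -> ~ acts_trivially (Z.of_nat n).
  move=> /andP[n0 np] tn; suff: (p <= n)%N by lia.
  by apply: minp; rewrite /P n0; apply/asboolP.
exists p; split=> //; apply/primeP; split.
  rewrite ltn_neqAle p_gt0 andbT; apply/eqP => p1.
  by apply: acts_nontrivially1; move: tp; rewrite -p1.
move=> d /dvdnP[b eqp]; rewrite -[_ || _]negbK negb_or; apply/negP => /andP[d1 dp].
have [d_gt0 b_gt0] : (0 < d)%N /\ (0 < b)%N by lia.
have ltd : (d < p)%N by nia.
have ltb : (b < p)%N by nia.
case: (acts_trivially_or_generates (Z.of_nat d)) => [|[i /acts_trivially_in ti]].
  by apply: lt_min; rewrite d_gt0.
apply: (lt_min b); first by rewrite b_gt0.
(* As p = bd, this writes b through two exponents that act trivially, against the minimality of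
   p. *)
have -> : Z.of_nat b = (1 - Z.of_nat d * i) * Z.of_nat b + Z.of_nat p * i.
  by rewrite eqp Nat2Z.inj_mul; lia.
by apply: acts_triviallyD; apply: acts_triviallyM.
Qed.

Lemma derived_power : exists M, 0 < M /\ G' (g ^^ M).
Proof.
have [p [p_pr tp]] := action_prime_order.
have p_gt1 := prime_gt1 p_pr.
case: (acts_trivially_or_generates (Z.of_nat p + 1)) => [tp1 | [i di]].
  case: acts_nontrivially1.
  have -> : 1 = (Z.of_nat p + 1) + Z.of_nat p * -1 by lia.
  by apply: acts_triviallyD => //; apply: acts_triviallyM.
move: di; set k := 1 - _ => di; exists (Z.abs k); split.
  suff : k <> 0 by lia.
  (* 1 - (p + 1) i is nonzero because p + 1 > 1 cannot divide 1. *)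
  have [?|?] : i <= 0 \/ 1 <= i by lia.
    by rewrite /k; nia.
  by rewrite /k; nia.
rewrite -Z.sgn_abs gpowM; exact: subgroup_gpow derived_subgroup di.
Qed.

(** On the abelian G' the map sending b to [b, g] is a homomorphism; its image is normal in G and
    contains all commutators of the generators, so it is G'. *)
Lemma derived_commutators a : G' a -> exists b, G' b /\ a = commutator b g.
Proof.
have [d1 [dM dV]] := derived_subgroup.
have comE b : commutator b g = inv b ** conj b g by gsimp.
have dJ b h : G' b -> G' (conj b h) by apply: normal_derived.
move: a; apply: (derived_min _ _ _ _ genG).
- split; first by exists e; split=> //; gsimp.
  split=> [_ _ [b [db ->]] [c [dc ->]] | _ [b [db ->]]].
    exists (b ** c); split; first exact: dM.
    rewrite !comE conjM ginvM; move: (dJ b g db) (dV c dc).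
    move: (conj b g) (inv c) => b' c' db' dc'.
    rewrite -!gmul_assoc (gmul_assoc _ b') (abG' b' c') // !gmul_assoc.
    by rewrite (abG' (inv b)) //; apply: dV.
  exists (inv b); split; first exact: dV.
  by rewrite !comE ginvM -conjV abG' //; auto.
- move=> _ h [b [db ->]]; have [c [k [dc ->]]] := cyclic_quotient_form h.
  (* The factor [c] of [h] centralises G', and g^k commutes with [g]. *)
  exists (conj b (g ^^ k)); split; first exact: dJ.
  rewrite -conjJ (conj_commute _ c); last first.
    by apply: abG' => //; rewrite comE; auto.
  by rewrite !comE conjM conjV !conjJ (commute_gpow g g k (erefl _)).
- move=> x y [dx|->] [dy|->].
  + by exists e; split=> //; rewrite (_ : commutator e g = e);
      [apply/commutatorP/abG' | gsimp].
  + by exists x.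
  + exists (inv y); split; first exact: dV.
    rewrite -commutatorV comE ginvM -conjV comE ginvK.
    by apply: abG' => //; auto.
  + by exists e; split=> //; gsimp.
Qed.

Lemma generators_mod_derived (s : list G) : exists l,
  (forall a, List.In a l -> G' a) /\
  forall x, List.In x s -> exists a k, List.In a l /\ x = a ** g ^^ k.
Proof.
elim: s => [|x s [l [dl ls]]]; first by exists nil.
have [a [k [da eqx]]] := cyclic_quotient_form x.
exists (a :: l); split=> [b [<-|]|y [<-|/ls[b [i [lb ->]]]]] //; first exact: dl.
  by exists a, k; split=> //; left.
by exists b, i; split=> //; right.
Qed.

(* The conjugates under <g> of the G'-parts of the generators generate a normal
   subgroup with cyclic quotient, hence all of G'. *)
Lemma derived_finitely_generated p : finitely_generated G ->
    0 < p -> acts_trivially p ->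
  exists L, (forall b, List.In b L -> G' b) /\
    forall a, G' a -> generated (fun y => List.In y L) a.
Proof.
move=> [s gens] p_gt0 tp.
have [l [dl ls]] := generators_mod_derived s.
(* Since g^p acts trivially, exponents below p already give all conjugates under powers of [g]. *)
pose L := List.flat_map (fun a =>
  List.map (fun i => conj a (g ^^ Z.of_nat i)) (List.seq 0 (Z.to_nat p))) l.
have LJ a k : List.In a l -> List.In (conj a (g ^^ k)) L.
  move=> la; apply/List.in_flat_map; exists a; split=> //.
  have ? := Z.mod_pos_bound k p p_gt0.
  apply/List.in_map_iff; exists (Z.to_nat (k mod p)).
  split; last by apply/List.in_seq; lia.
  rewrite Z2Nat.id; last lia.
  rewrite (gpow_div_mod g p k) -conjJ (conj_commute a ((g ^^ p) ^^ (k / p))) //.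
  by rewrite -gpowM; apply: (acts_triviallyM p (k / p) tp a (dl a la)).
have LE b : List.In b L -> exists a k, List.In a l /\ b = conj a (g ^^ k).
  move=> /List.in_flat_map[a [la /List.in_map_iff[i [<- _]]]].
  by exists a, (Z.of_nat i).
have dL b : List.In b L -> G' b.
  by move=> /LE[a [k [/dl da ->]]]; apply: normal_derived.
exists L; split=> //; pose A0 := generated (fun y => List.In y L).
have sA0 : is_subgroup A0 by apply: generated_subgroup.
have [A01 [A0M A0V]] := sA0.
have dA0 a : A0 a -> G' a by move=> A0a; apply: A0a derived_subgroup dL.
have A0J k a : A0 a -> A0 (conj a (g ^^ k)).
  move=> A0a; apply: (A0a (fun x => A0 (conj x (g ^^ k)))).
    split; first by rewrite (_ : conj e _ = e) //; gsimp.
    split=> [x y A0x A0y | x A0x]; first by rewrite conjM; apply: A0M.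
    by rewrite conjV; apply: A0V.
  move=> _ /LE[b [i [lb ->]]]; rewrite conj_gpow.
  by apply: mem_generated; apply: LJ.
apply: (derived_min A0 (fun y => A0 y \/ y = g)) => //.
- move=> a x A0a; have [b [k [db ->]]] := cyclic_quotient_form x.
  rewrite -conjJ (conj_commute a); first exact: A0J.
  by apply: abG' => //; apply: dA0.
- move=> x; apply: gens; first exact: generated_subgroup.
  move=> y /ls[a [k [la ->]]].
  have [_ [gM _]] := generated_subgroup (fun y => A0 y \/ y = g).
  apply: gM; last first.
    apply: (subgroup_gpow _ g k (generated_subgroup _)).
    by apply: mem_generated; right.
  apply: mem_generated; left; apply: mem_generated.
  by have := LJ a 0 la; rewrite conj1.
have A0g a : A0 a -> A0 (commutator a g).
  move=> A0a; have -> : commutator a g = inv a ** conj a (g ^^ 1).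
    by rewrite gpow1; gsimp.
  by apply: (A0M); [apply: A0V | apply: A0J].
move=> x y [A0x|->] [A0y|->].
- rewrite (_ : commutator x y = e) //; apply/commutatorP.
  by apply: abG'; apply: dA0.
- exact: A0g.
- by rewrite -commutatorV; apply: A0V; apply: A0g.
- by rewrite (_ : commutator g g = e) //; gsimp.
Qed.

End CyclicQuotient.
End NonabelianYn.
End Groups.

(** * Abelian subgroups in additive notation *)

(** The proofs [sA] and [cA] are parameters of the type so that its additive structure can be
    inferred from it. *)
Definition abelian_subgroup (G : Group) (A : G -> Prop)
  (sA : is_subgroup G A) (cA : abelian_set G A) : Type := {x : G | A x}.

Section AbelianSubgroup.
Variables (G : Group) (A : G -> Prop).
Hypotheses (sA : is_subgroup G A) (cA : abelian_set G A).
Local Notation T := (abelian_subgroup G A sA cA).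

HB.instance Definition _ := gen_eqMixin T.
HB.instance Definition _ := gen_choiceMixin T.

Let sM := proj1 (proj2 sA).
Let sV := proj2 (proj2 sA).
Let add (u v : T) : T :=
  exist A (gmul G (sval u) (sval v)) (sM _ _ (svalP u) (svalP v)).
Let opp (u : T) : T := exist A (ginv G (sval u)) (sV _ (svalP u)).
Let zero : T := exist A (gone G) (proj1 sA).

Lemma abelian_subgroup_inj (u v : T) : sval u = sval v -> u = v.
Proof. by case: u v => [x Ax] [y Ay] /= eqxy; apply: eq_exist. Qed.

Fact abelian_subgroup_addA : associative add.
Proof. by move=> u v w; apply: abelian_subgroup_inj; apply: gmul_assoc. Qed.

Fact abelian_subgroup_addC : commutative add.
Proof. by move=> u v; apply: abelian_subgroup_inj; apply: cA; apply: svalP. Qed.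

Fact abelian_subgroup_add0 : left_id zero add.
Proof. by move=> u; apply: abelian_subgroup_inj; apply: gmul_1l. Qed.

Fact abelian_subgroup_addN : left_inverse zero opp add.
Proof. by move=> u; apply: abelian_subgroup_inj; apply: gmul_Vl. Qed.

HB.instance Definition _ := GRing.isZmodule.Build T abelian_subgroup_addA
  abelian_subgroup_addC abelian_subgroup_add0 abelian_subgroup_addN.

(** Additively, conjugation by [g] is an endomorphism f with f^p = 1, and [b, g] is f b - b, so
    [prime_order_action_finite] applies. *)
Lemma abelian_subgroup_finite (g : G) (p : nat) (s : list G) :
    prime p -> (forall a, A a -> A (Defs.conj G a g)) ->
    (forall a, A a -> commute G a (gpow G g (Z.of_nat p))) ->
    (forall a, A a -> exists b, A b /\ a = commutator G b g) ->
    (forall b, List.In b s -> A b) ->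
    (forall a, A a -> generated G (fun y => List.In y s) a) ->
  exists L, forall a, A a -> List.In a L.
Proof.
move=> p_pr nA gp comA As gens.
pose f (u : T) : T := exist A (Defs.conj G (sval u) g) (nA _ (svalP u)).
have fB : GRing.zmod_morphism f.
  move=> u v; apply: abelian_subgroup_inj.
  by rewrite /= conjM conjV.
pose F : {additive T -> T} := HB.pack f (GRing.isZmodMorphism.Build T T f fB).
have iterF n (u : T) : sval (iter n F u) = Defs.conj G (sval u) (gpow G g (Z.of_nat n)).
  elim: n => [|n IHn]; first by rewrite conj1.
  by rewrite Nat2Z.inj_succ -Z.add_1_r gpowD gpow1 -conjJ -IHn.
have [s' s'E] : exists s' : seq T, List.map (fun u => sval u) s' = s.
  elim: s As {gens} => [|b s IHs] As; first by exists [::].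
  have [c cs|s' <-] := IHs; first by apply: As; right.
  by exists (exist A b (As b (or_introl erefl)) :: s').
have span_s' (u : T) : int_span T s' u.
  (* [generated] ranges over subgroups of [G], so the span is replaced by its image in [G]. *)
  have [v [/abelian_subgroup_inj <-]] //: exists v : T, sval v = sval u /\ int_span T s' v.
  apply: (gens _ (svalP u) (fun x => exists v : T, sval v = x /\ int_span T s' v)).
    split; first by exists 0%R; split=> //; apply: int_span0.
    split=> [_ _ [v [<- sv]] [w [<- sw]] | _ [v [<- sv]]].
      by exists (v + w)%R; split=> //; apply: int_spanD.
    by exists (- v)%R; split=> //; apply: int_spanN.
  move=> b; rewrite -s'E => /List.in_map_iff[v [<- s'v]].
  by exists v; split=> //; apply: mem_int_span.
have [||t tV] := prime_order_action_finite T p F s' p_pr _ _ span_s'.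
- move=> u; apply: abelian_subgroup_inj; rewrite iterF.
  by apply: conj_commute; apply: gp; apply: svalP.
- move=> u; have [b [Ab eqb]] := comA _ (svalP u).
  exists (exist A b Ab); apply: abelian_subgroup_inj; rewrite eqb /=.
  rewrite cA; [|exact: (nA b Ab)|exact: (sV b Ab)].
  by rewrite /commutator /Defs.conj -!gmul_assoc.
exists (List.map (fun u => sval u) t) => a Aa.
by apply/List.in_map_iff; exists (exist A a Aa).
Qed.
End AbelianSubgroup.

(** * The two cases combined *)

Theorem theorem3p2 (G : Group) :
  in_Yn G -> infinite_group G -> finitely_generated G -> soluble G ->
  abelian_group G.
Proof.
move=> YnG infG fgG solG; apply: contrapT => nabG.
have abG' := derived_abelian G YnG nabG solG.
case: (EM (exists g, ~ abelian_set G (generated G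
    (fun y => derived G (fun _ => True) y \/ y = g)))) => [[g nabg]|allab].
  have genG : forall x, generated G (fun y => derived G (fun _ => True) y \/ y = g) x.
    case: (over_derived_abelian_or_full G YnG _
      (generated_subgroup G (fun y => derived G (fun _ => True) y \/ y = g))) => //.
    by move=> z dz; apply: mem_generated; left.
  have [p [p_pr tp]] := action_prime_order G YnG nabG g abG' genG.
  have p_gt0 : Z.lt Z0 (Z.of_nat p) by have := prime_gt0 p_pr; lia.
  have [L [dL genL]] := derived_finitely_generated G g abG' genG _ fgG p_gt0 tp.
  have [B BP] := abelian_subgroup_finite G _ (derived_subgroup G) abG' g p L p_pr
    (fun a => normal_derived G a g) tp (derived_commutators G g abG' genG) dL genL.
  have [M [M_gt0 dM]] := derived_power G YnG nabG g abG' genG.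
  have [C CP] := gpow_mod_list G g M M_gt0.
  have [W WP] := gmul_list G B C; have [x []] := infG W.
  have [a [k [da ->]]] := cyclic_quotient_form G g genG x.
  (* The multiple of M in the exponent is absorbed into the finite G', leaving finitely many powers
     of [g]. *)
  rewrite (gpow_div_mod G g M k) gmul_assoc; apply: WP => //; apply: BP.
  have [_ [derM _]] := derived_subgroup G; apply: derM => //.
  exact: subgroup_gpow (derived_subgroup G) dM.
(* Each [z] lies with G' in an abelian subgroup, so G' is central. *)
apply: central_derived_finite infG => // a z da.
apply: contrapT => ncaz; apply: allab; exists z => abz; apply: ncaz.
by apply: abz; apply: mem_generated; auto.
Qed.
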